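(* For every integer $k\ge 0$, the number $a(2k+1)$ of near-perfect matchings of the $(2k+1)\times(2k+1)$ grid graph is an odd multiple of $2^k$, i.e. $a(2k+1)=2^k c_k$ with $c_k$ odd.
   Context: The $m\times n$ grid graph has vertex set $\{1,\dots,m\}\times\{1,\dots,n\}$, with two vertices adjacent when they differ by $1$ in exactly one coordinate. For a graph with an odd number of vertices, a near-perfect matching is a set of pairwise disjoint edges covering all vertices but one. *)

(* Defs.v *)
From mathcomp Require Import all_boot.

Set Implicit Arguments.
Unset Strict Implicit.
Unset Printing Implicit Defensive.

(* Coordinates are 0-based. *)
Definition grid_vertex (m n : nat) : finType := ('I_m * 'I_n)%type.

Definition differ_by_1 (i j : nat) : bool := (i == j.+1) || (j == i.+1).

Definition grid_adj (m n : nat) : rel (grid_vertex m n) :=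
  fun u v => (differ_by_1 u.1 v.1 && (u.2 == v.2))
          || ((u.1 == v.1) && differ_by_1 u.2 v.2).

(* A simple graph is a symmetric irreflexive relation on a finite type; its
   edges are the two-element sets of adjacent vertices. *)
Definition edge_set (T : finType) (adj : rel T) : {set {set T}} :=
  [set e : {set T} | [exists u, exists v, adj u v && (e == [set u; v])]].

Definition is_matching (T : finType) (adj : rel T) (M : {set {set T}}) : bool :=
  (M \subset edge_set adj) && trivIset M.

Definition is_near_perfect_matching (T : finType) (adj : rel T)
    (M : {set {set T}}) : bool :=
  is_matching adj M && (#|~: cover M| == 1).

Definition num_near_perfect_matchings (T : finType) (adj : rel T) : nat :=
  #|[set M : {set {set T}} | is_near_perfect_matching adj M]|.

Definition a (n : nat) : nat :=
  num_near_perfect_matchings (@grid_adj n n).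

(* Main.v *)
Require Import Defs.
From mathcomp Require Import all_boot zify.

Set Implicit Arguments.
Unset Strict Implicit.
Unset Printing Implicit Defensive.

(* Encode a near-perfect matching as an involution f with one fixed point that
   moves every other vertex to a neighbour.  Let s be the reflection in the
   diagonal and t the reflection in the antidiagonal.  On each orbit of <f, s>
   one may replace f by s f s, so the number of matchings with the same
   superposition f + s f s is 2^m, where m counts the orbits on which f and
   s f s differ.  Such an orbit contains at most two diagonal vertices, there
   are 2k+1 of those, and at most one of them is the monomer; hence m >= k.

   It remains to see that the number of superpositions with m = k is odd, and
   for this the ones invariant under t suffice.  If m = k and t preserves the
   superposition, the monomer is the center.  Every antidiagonal vertex lies in
   a switchable orbit, which contains at most two of them, so each of the k
   orbits contains antidiagonal vertices; therefore it is stable under t and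
   contains at most one of the first k diagonal vertices.  After switching,
   each of the first k diagonal vertices is matched above the diagonal, and
   this forces the whole matching, going row by row through the top quadrant
   and then turning by 90 degrees: it is a pinwheel of concentric rings. *)

(** * Near-perfect matchings as involutions with one fixed point *)

Section MatchingInvolution.
Variables (T : finType) (adj : rel T).
Hypothesis adj_irr : irreflexive adj.
Hypothesis adj_sym : symmetric adj.

Definition near_perfect_involutions : {set {ffun T -> T}} :=
  [set f : {ffun T -> T} | [&& [forall x, f (f x) == x],
     [forall x, (f x == x) || adj x (f x)] & #|[set x | f x == x]| == 1]].

Lemma npiP (f : {ffun T -> T}) :
  reflect [/\ involutive f, forall x, f x = x \/ adj x (f x)
            & exists v, forall x, (f x = x) <-> x = v]
          (f \in near_perfect_involutions).
Proof.
rewrite inE; apply: (iffP and3P) => [[/forallP f2 /forallP fadj fix1]|[f2 fadj [v fv]]].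
  split=> [x|x|]; first exact/eqP.
    by case/orP: (fadj x) => [/eqP|]; [left | right].
  case/cards1P: fix1 => v /setP fv; exists v => x; move: (fv x).
  by rewrite !inE => e; split=> [/eqP|/eqP xv]; [rewrite e => /eqP | apply/eqP; rewrite e].
split; first by apply/forallP => x; rewrite f2.
  by apply/forallP => x; case: (fadj x) => [->|->]; rewrite ?eqxx ?orbT.
apply/cards1P; exists v; apply/setP=> x; rewrite !inE.
by apply/eqP/eqP => /fv.
Qed.

Definition matching_of (f : {ffun T -> T}) : {set {set T}} :=
  [set [set x; f x] | x in [set x | f x != x]].

Lemma eq_set2 (x y z w : T) :
  [set x; y] = [set z; w] -> x = z /\ y = w \/ x = w /\ y = z.
Proof.
move=> /setP e; move: (e x) (e y) (e z) (e w); rewrite !inE !eqxx ?orbT /=.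
move/esym/orP=> hx /esym/orP hy /orP hz /orP hw.
by case: hx => /eqP hx; case: hy => /eqP hy; subst; auto;
  case: hz => /eqP hz; case: hw => /eqP hw; subst; auto.
Qed.

Lemma mem_matching_of (f : {ffun T -> T}) x y : involutive f ->
  ([set x; y] \in matching_of f) = (f x == y) && (x != y).
Proof.
move=> f2; apply/imsetP/andP => [[z]|[/eqP fx xy]].
  rewrite inE => fz /eq_set2 [[-> ->]|[-> ->]]; first by rewrite eqxx eq_sym.
  by rewrite f2.
by exists x; rewrite ?inE fx // eq_sym.
Qed.

Lemma trivIset_mem_eq (M : {set {set T}}) (B C : {set T}) x :
  trivIset M -> B \in M -> C \in M -> x \in B -> x \in C -> B = C.
Proof.
move=> tM BM CM xB xC.
by rewrite -(def_pblock tM BM xB) (def_pblock tM CM xC).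
Qed.

Lemma matching_of_np f : f \in near_perfect_involutions ->
  is_near_perfect_matching adj (matching_of f).
Proof.
case/npiP=> f2 fadj [v fv].
rewrite /is_near_perfect_matching /is_matching -andbA; apply/and3P; split.
- apply/subsetP=> B /imsetP[x]; rewrite inE => fx ->.
  rewrite inE; apply/existsP; exists x; apply/existsP; exists (f x).
  by rewrite eqxx andbT; case: (fadj x) fx => [->|//]; rewrite eqxx.
- apply/trivIsetP => B C /imsetP[x _ ->] /imsetP[y _ ->].
  apply: contraNT => /pred0Pn [z /andP[]]; rewrite !inE.
  case/orP=> /eqP-> /orP[]/eqP e.
  + by rewrite e.
  + by rewrite e f2 setUC.
  + by rewrite -e f2 setUC.
  + by rewrite (can_inj f2 e).
- apply/cards1P; exists v; apply/setP => x; rewrite !inE.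
  apply/negP/eqP => [xM|-> ]; last first.
    case/bigcupP => B /imsetP [y]; rewrite inE => fy ->.
    have fvv := proj2 (fv v) erefl.
    rewrite !inE => /orP[]/eqP e; first by rewrite -e fvv eqxx in fy.
    by move/(congr1 f): e; rewrite f2 fvv => e; rewrite -e fvv eqxx in fy.
  apply/fv/eqP; apply: contra_notT xM => fx; apply/bigcupP.
  by exists [set x; f x]; [apply/imsetP; exists x; rewrite ?inE | rewrite !inE eqxx].
Qed.

(** Each covered vertex has exactly one partner, since two edges of [M] that share a vertex
    coincide; exchanging partners is the involution sought. *)
Lemma matching_of_surj (M : {set {set T}}) :
  is_near_perfect_matching adj M ->
  exists2 f, f \in near_perfect_involutions & M = matching_of f.
Proof.
case/andP=> /andP[/subsetP sub tM] /cards1P[v /setP cov].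
(* The default [x] turns the uncovered vertex [v] into the fixed point. *)
pose f : {ffun T -> T} := [ffun x => odflt x [pick y | [set x; y] \in M]].
have Madj x y : [set x; y] \in M -> adj x y.
  move/sub; rewrite inE => /existsP[z /existsP[w /andP[azw /eqP]]].
  by case/eq_set2 => [[-> ->]|[-> ->]] //; rewrite adj_sym.
have Muniq x y z : [set x; y] \in M -> [set x; z] \in M -> y = z.
  move=> yM zM; have := trivIset_mem_eq tM yM zM (set21 _ _) (set21 _ _).
  by case/eq_set2 => [[_ ->]|[-> ->]].
have fM x y : [set x; y] \in M -> f x = y.
  move=> xyM; rewrite ffunE; case: pickP => [z|/(_ y)]; last by rewrite xyM.
  by move/Muniq; apply.
have cover_ex x : x != v -> exists y, [set x; y] \in M.
  move: (cov x); rewrite !inE => <-; rewrite negbK => /bigcupP[B BM xB].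
  move/sub: (BM); rewrite inE => /existsP[z /existsP[w /andP[_ /eqP e]]].
  move: xB; rewrite e !inE => /orP[]/eqP->; first by exists w; rewrite -e.
  by exists z; rewrite setUC -e.
have fv : f v = v.
  rewrite ffunE; case: pickP => //= y vy.
  have: v \in cover M by apply/bigcupP; exists [set v; y]; rewrite ?set21.
  by move: (cov v); rewrite !inE eqxx => /negbTE->.
have neq x y : [set x; y] \in M -> x != y.
  by move/Madj => axy; apply/eqP => e; rewrite e adj_irr in axy.
have f2 : involutive f.
  move=> x; have [->|/cover_ex[y xy]] := eqVneq x v; first by rewrite !fv.
  by rewrite (fM _ _ xy); apply: fM; rewrite setUC.
have fin : f \in near_perfect_involutions.
  apply/npiP; split=> // [x|]; last exists v => x.
    have [->|/cover_ex[y xy]] := eqVneq x v; first by left.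
    by right; rewrite (fM _ _ xy); apply: Madj.
  split=> [fx|-> //]; apply/eqP/negPn/negP => /cover_ex[y xy].
  by have := neq _ _ xy; rewrite -(fM _ _ xy) fx eqxx.
exists f => //; apply/setP => B; apply/idP/idP => [BM|].
  move/sub: (BM); rewrite inE => /existsP[z /existsP[w /andP[_ /eqP e]]].
  by move: BM; rewrite e => BM; rewrite mem_matching_of // (fM _ _ BM) eqxx neq.
case/imsetP=> x; rewrite inE => fx ->.
have [e|/cover_ex[y xy]] := eqVneq x v; first by rewrite e fv eqxx in fx.
by rewrite (fM _ _ xy).
Qed.

Lemma num_near_perfect_matchingsE :
  num_near_perfect_matchings adj = #|near_perfect_involutions|.
Proof.
rewrite /num_near_perfect_matchings -(card_in_imset (f := matching_of)).
  congr #|pred_of_set _|; apply/setP=> M; rewrite inE.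
  apply/idP/imsetP => [/matching_of_surj[f fX ->]|[f fX ->]]; first by exists f.
  exact: matching_of_np.
move=> f g /npiP[f2 _ _] /npiP[g2 _ _] e; apply/ffunP=> x.
have [fx|fx] := eqVneq (f x) x.
  rewrite fx; apply/esym/eqP/negPn/negP => gx.
  have: [set x; g x] \in matching_of f by rewrite e mem_matching_of // eqxx eq_sym.
  by rewrite mem_matching_of // fx => /andP[/eqP xg]; rewrite -xg eqxx.
have: [set x; f x] \in matching_of g by rewrite -e mem_matching_of // eqxx eq_sym.
by rewrite mem_matching_of // => /andP[/eqP].
Qed.

End MatchingInvolution.

(** * Conjugation, parity counts, and reflections of a cycle *)

(** Map and inverse are separate arguments because conjugation is used with the quarter turn as well
    as with reflections. *)
Definition conj_fun (T : finType) (s s' : T -> T) (f : {ffun T -> T}) :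
  {ffun T -> T} := [ffun x => s' (f (s x))].

Lemma conj_fun_npi (T : finType) (adj : rel T) (s s' : T -> T) f :
    cancel s s' -> cancel s' s -> (forall x y, adj x y -> adj (s' x) (s' y)) ->
  f \in near_perfect_involutions adj ->
  conj_fun s s' f \in near_perfect_involutions adj.
Proof.
move=> sK s'K s'adj /npiP[f2 fadj [v fv]]; apply/npiP; split=> [x|x|].
- by rewrite !ffunE s'K f2 sK.
- rewrite ffunE; case: (fadj (s x)) => [->|/s'adj]; first by left.
  by rewrite sK; right.
exists (s' v) => x; rewrite ffunE; split=> [e|->].
  by rewrite -(proj1 (fv (s x))) ?sK // -[LHS]s'K e.
by rewrite s'K (proj2 (fv v) erefl).
Qed.

Lemma odd_sum (T : finType) (A : {set T}) (w : T -> nat) :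
  odd (\sum_(x in A) w x) = odd #|[set x in A | odd (w x)]|.
Proof.
rewrite -sum1_card; under [in RHS]eq_bigl do rewrite inE.
rewrite big_mkcondr /=; apply: (big_ind2 (fun m n => odd m = odd n)) => //.
  by move=> m1 n1 m2 n2 e1 e2; rewrite !oddD e1 e2.
by move=> x _; case: ifP.
Qed.

Lemma odd_card_unique_fixpoint (T : finType) (t : T -> T) (A : {set T}) x0 :
    involutive t -> (forall x, x \in A -> t x \in A) -> x0 \in A ->
    (forall x, x \in A -> (t x = x <-> x = x0)) ->
  odd #|A|.
Proof.
move=> tK tA x0A fixt.
(* [L] picks the element of smaller rank from each two-element orbit of [t] in [A], so [A] splits
   into [x0], [L] and the image of [L]. *)
pose L := [set x in A | enum_rank x < enum_rank (t x)].
have tx0 : t x0 = x0 by apply/fixt.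
have mem_tL x : (x \in t @: L) = (t x \in L) by rewrite -{1}[x]tK (mem_imset _ _ (inv_inj tK)).
have -> : A = x0 |: (L :|: t @: L).
  apply/setP=> x; rewrite !inE mem_tL !inE tK.
  have tAe : (t x \in A) = (x \in A).
    by apply/idP/idP=> /tA //; rewrite tK.
  rewrite tAe -andb_orr -neq_ltn; have [->//|xx0] := eqVneq x x0.
  have [xA|//] := boolP (x \in A); apply/esym.
  apply: contra xx0 => /eqP /ord_inj /enum_rank_inj /esym tx.
  by apply/eqP/fixt.
rewrite cardsU1 cardsU (_ : L :&: t @: L = set0) ?cards0 ?subn0; last first.
  apply/setP=> x; rewrite !inE mem_tL !inE tK.
  by case: ltngtP => //; rewrite ?andbF.
rewrite card_imset; last exact: (inv_inj tK).
rewrite addnn oddD odd_double.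
by rewrite !inE mem_tL !inE !tx0 ltnn !andbF.
Qed.

Lemma card_le_fibers (T U : finType) (h : T -> U) (A : {set T}) m :
    (forall x, x \in A -> #|[set y in A | h y == h x]| <= m) ->
  #|A| <= m * #|h @: A|.
Proof.
move=> hm; rewrite -sum1_card (partition_big_imset h) /= mulnC -sum_nat_const.
apply: leq_sum => _ /imsetP[x xA ->].
by apply: leq_trans (hm x xA); rewrite -sum1_card; apply: eq_leq; apply: eq_bigl => y; rewrite inE.
Qed.

(** The relation [p s p = s] makes [s] act on the cycle of [p] as a reflection. If [s] fixes [x], it
    sends the [i]-th iterate of [x] to the [i]-th backward one, so it fixes this iterate only if the
    order divides [2i]. Below the order this leaves [i = 0] and half the order. *)
Lemma card_fixed_orbit_le2 (T : finType) (p s : T -> T) x0 :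
    injective p ->
    (forall x, fconnect p x0 x -> p (s (p x)) = s x) ->
  #|[set x | fconnect p x0 x & s x == x]| <= 2.
Proof.
move=> p_inj sp.
have [->|[x]] := set_0Vmem [set x | fconnect p x0 x & s x == x]; first by rewrite cards0.
rewrite inE => /andP[x0x /eqP sx].
have p_s i : iter i p (s (iter i p x)) = x.
  elim: i => [|i IHi] //=; rewrite -iterS iterSr sp //.
  exact: connect_trans x0x (fconnect_iter _ _ _).
apply: (@leq_trans #|[set x; iter (order p x)./2 p x]|); last by rewrite cards2; case: (_ == _).
apply/subset_leq_card/subsetP => y; rewrite !inE => /andP[x0y /eqP sy].
have xy : fconnect p x y by apply: connect_trans x0y; rewrite fconnect_sym.
have lt_m := findex_max xy; have def_y := iter_findex xy.
set i := findex p x y in lt_m def_y.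
have : iter i.*2 p x = x by rewrite -addnn iterD def_y -sy -def_y p_s.
have [lt2|ge2] := ltnP i.*2 (order p x).
  move/(congr1 (findex p x)); rewrite findex_iter // findex0 => /eqP.
  by rewrite double_eq0 -def_y => /eqP-> /=; rewrite eqxx.
rewrite -(subnK ge2) iterD iter_order //.
have lt3 : i.*2 - order p x < order p x by lia.
move/(congr1 (findex p x)); rewrite findex_iter // findex0 => /eqP.
rewrite subn_eq0 => le2; have -> : order p x = i.*2 by apply/eqP; rewrite eqn_leq ge2.
by rewrite doubleK def_y eqxx orbT.
Qed.

(** * Superpositions and switching along a reflection *)

Section Switching.
Variables (T : finType) (adj : rel T) (s : T -> T).
Hypotheses (s_adj : forall x y, adj x y -> adj (s x) (s y)) (sK : involutive s).
Implicit Types (f g : {ffun T -> T}) (A : {set T}).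
Notation X := (near_perfect_involutions adj).

(* Encodes the union of the matching of f with its mirror image: the value at x
   is the set of partners of x, forgetting which of the two each comes from. *)
Definition superposition f : {ffun T -> {set T}} :=
  [ffun x => [set f x; s (f (s x))]].

(** For involutions [f] and [s] this is the orbit of [x] under the group they generate: each step
    can be undone, so reachability is symmetric. *)
Definition component f x : {set T} :=
  [set y | connect (fun u v => (v == f u) || (v == s u)) x y].

Definition switchable f : {set {set T}} :=
  [set component f x | x in [set x | f x != s (f (s x))]].

Definition switch f A : {ffun T -> T} :=
  [ffun x => if x \in A then s (f (s x)) else f x].

Lemma component_id f x : x \in component f x.
Proof. by rewrite inE. Qed.

Lemma component_eq f x y : involutive f ->
  y \in component f x -> component f y = component f x.
Proof.
move=> fK; rewrite inE => xy; apply/setP=> z; rewrite !inE.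
apply/esym/same_connect => //; apply: sym_connect_sym => u v.
by rewrite /= [v == f u]eq_sym [v == s u]eq_sym (can2_eq fK fK) (can2_eq sK sK).
Qed.

Lemma mem_component f x y : involutive f ->
  (y \in component f x) = (component f y == component f x).
Proof.
move=> fK; apply/idP/eqP => [|<-]; [exact: component_eq | exact: component_id].
Qed.

Lemma component_f f x : involutive f -> component f (f x) = component f x.
Proof. by move=> fK; apply: component_eq => //; rewrite inE connect1 ?eqxx. Qed.

Lemma component_s f x : involutive f -> component f (s x) = component f x.
Proof. by move=> fK; apply: component_eq => //; rewrite inE connect1 ?eqxx ?orbT. Qed.

Lemma component_min f (P : pred T) x y :
    (forall u, P u -> P (f u)) -> (forall u, P u -> P (s u)) ->
  y \in component f x -> P x -> P y.
Proof.
move=> Pf Ps; rewrite inE => /connectP[q]; elim: q x => [|z q IHq] x /= => [_ -> //|].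
case/andP=> xz qz def_y Px; apply: IHq qz def_y _.
by case/orP: xz => /eqP->; [apply: Pf | apply: Ps].
Qed.

(** Since [s] fixes [d], it sends the [i]-th iterate of [d] under [s \o f] to the [i]-th backward
    iterate. The cycle of [s \o f] through [d] is thus closed under [s], hence under [f], and is the
    whole orbit. *)
Lemma component_fixed f d : involutive f -> s d = d ->
  component f d = [set x | fconnect (s \o f) d x].
Proof.
move=> fK sd; have p_inj : injective (s \o f) by apply: inj_comp; apply: can_inj; eauto.
have iter_s i : iter i (s \o f) (s (iter i (s \o f) d)) = d.
  by elim: i => [|i IHi] //; rewrite iterSr [iter i.+1 _ d]/= sK /= fK.
have conn_s u : fconnect (s \o f) d u -> fconnect (s \o f) d (s u).
  move/iter_findex=> def_u; rewrite fconnect_sym //.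
  by have := iter_s (findex (s \o f) d u); rewrite def_u => <-; apply: fconnect_iter.
apply/setP=> y; rewrite [RHS]inE; apply/idP/idP => [|/iter_findex <-].
  move/component_min; apply; rewrite ?connect0 // => u du.
  by rewrite -[f u]sK conn_s // -[s _]/((s \o f) u) -same_fconnect1_r.
elim: (findex _ _ _) => [|i IHi] /=; first exact: component_id.
by rewrite -(component_eq fK IHi) -component_f // -component_s // component_id.
Qed.

Lemma mem_cover_switchable f x (B : {set {set T}}) : involutive f ->
  B \subset switchable f -> (x \in cover B) = (component f x \in B).
Proof.
move=> fK /subsetP BO; apply/bigcupP/idP => [[C CB xC]|xB].
  case/imsetP: (BO _ CB) => y _ def_C; rewrite def_C in xC CB.
  by rewrite (component_eq fK xC).
by exists (component f x) => //; apply: component_id.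
Qed.

Lemma switch_npi f A : f \in X ->
    (forall x, (f x \in A) = (x \in A)) -> (forall x, (s x \in A) = (x \in A)) ->
  switch f A \in X.
Proof.
move=> /npiP[fK fadj [v fv]] fA sA; apply/npiP; split=> [x|x|].
- rewrite !ffunE; have [xA|/negbTE xA] := boolP (x \in A); last by rewrite fA xA fK.
  by rewrite sA fA sA xA sK fK sK.
- rewrite ffunE; case: ifP => xA; last exact: fadj.
  case: (fadj (s x)) => [->|/s_adj]; first by left.
  by rewrite sK; right.
(* If the monomer [v] lies in [A], switching mirrors it as well. *)
exists (if v \in A then s v else v) => x; rewrite ffunE.
have fvv := proj2 (fv v) erefl.
case: ifP => xA; case: ifP => vA; split.
- by move=> e; rewrite -(proj1 (fv (s x))) ?sK // -[LHS]sK e.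
- by move=> ->; rewrite sK fvv.
- by move=> e; rewrite -(proj1 (fv (s x))) ?sA ?xA // -[LHS]sK e in vA.
- by move=> e; rewrite e vA in xA.
- by move/fv=> e; rewrite e vA in xA.
- by move=> e; rewrite e sA vA in xA.
- by move/fv.
- by move->.
Qed.

Lemma superposition_switch f A :
    (forall x, (s x \in A) = (x \in A)) ->
  superposition (switch f A) = superposition f.
Proof.
move=> sA; apply/ffunP => x; rewrite !ffunE sA; case: ifP => // _.
by rewrite !sK setUC.
Qed.

Lemma superposition_eq_cases f g x : superposition g = superposition f ->
  g x = f x /\ s (g (s x)) = s (f (s x)) \/ g x = s (f (s x)) /\ s (g (s x)) = f x.
Proof. by move/ffunP/(_ x); rewrite !ffunE => /eq_set2[[-> ->]|[-> ->]]; auto. Qed.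

(** Agreement of [g] with [f] at a vertex passes to its images under [f] and [s]. So on each orbit
    [g] equals [f] throughout, or differs from [f] throughout and is then the mirror image
    [s f s]. *)
Lemma eq_superposition_component f g x y : f \in X -> g \in X ->
    superposition g = superposition f -> y \in component f x ->
  (g y == f y) = (g x == f x).
Proof.
move=> /npiP[fK _ _] /npiP[gK _ _] e.
have agree_f u : (g (f u) == f (f u)) = (g u == f u).
  by rewrite fK (can2_eq gK gK) eq_sym.
have agree_s u : (g (s u) == f (s u)) = (g u == f u).
  have [[-> /(can_inj sK)->]|[gu gsu]] := superposition_eq_cases u e.
    by rewrite !eqxx.
  by rewrite gu -(inj_eq (can_inj sK)) gsu eq_sym.
move=> xy; apply: (@eqP bool).
by apply: (@component_min f (fun u => (g u == f u) == (g x == f x)) x y _ _ xy) => // u;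
  rewrite ?agree_f ?agree_s.
Qed.

(** Switching along the union of a set of switchable orbits gives a bijection from the subsets of
    [switchable s f] onto the fiber. *)
Lemma card_superposition_fiber f : f \in X ->
  #|[set g in X | superposition g == superposition f]| = 2 ^ #|switchable f|.
Proof.
move=> fX; have [fK _ _] := npiP _ _ fX.
have covf (B : {set {set T}}) x : B \subset switchable f -> (f x \in cover B) = (x \in cover B).
  by move=> BO; rewrite !(mem_cover_switchable _ fK BO) component_f.
have covs (B : {set {set T}}) x : B \subset switchable f -> (s x \in cover B) = (x \in cover B).
  by move=> BO; rewrite !(mem_cover_switchable _ fK BO) component_s.
rewrite -card_powerset -(card_in_imset (f := fun B => switch f (cover B))); last first.
  (* Injectivity: a switchable orbit [C] contains a vertex where [f] and [s f s] differ, and the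
     switched involution shows there whether [C] was chosen. *)
  have sub (B1 B2 : {set {set T}}) : B1 \subset switchable f -> B2 \subset switchable f ->
      switch f (cover B1) = switch f (cover B2) -> B1 \subset B2.
    move=> O1 O2 /ffunP e; apply/subsetP => C CB1.
    case/imsetP: (subsetP O1 _ CB1) => x; rewrite inE => fx def_C.
    move: (e x); rewrite !ffunE !(mem_cover_switchable _ fK) // -def_C CB1.
    by case: ifP => // _ /esym/eqP; rewrite (negbTE fx).
  move=> B1 B2; rewrite !inE => O1 O2 e; apply/eqP; rewrite eqEsubset.
  by apply/andP; split; apply: sub.
congr #|pred_of_set _|; apply/setP=> g; rewrite inE; apply/andP/imsetP; last first.
  case=> B; rewrite inE => BO ->; split.
    by apply: switch_npi => // x; rewrite ?covf ?covs.
  by rewrite superposition_switch // => x; rewrite covs.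
(* Surjectivity: [g] arises by switching exactly the orbits on which it differs from [f]. *)
case=> gX /eqP e; pose B := [set component f x | x in [set x | g x != f x]].
have BO : B \subset switchable f.
  apply/subsetP=> C /imsetP[x]; rewrite inE => gx ->; apply/imsetP; exists x => //.
  rewrite inE; have [[h _]|[h _]] := superposition_eq_cases x e; first by rewrite h eqxx in gx.
  by rewrite -h eq_sym.
exists B; first by rewrite inE.
apply/ffunP=> x; rewrite ffunE (mem_cover_switchable _ fK BO); case: ifP => [|/negP xB].
  case/imsetP => y; rewrite inE => gy xy.
  have: g x != f x by rewrite (@eq_superposition_component f g y) // -xy component_id.
  by case: (superposition_eq_cases x e) => [[-> _]|[-> _]]//; rewrite eqxx.
by apply/eqP; apply/negPn/negP => gx; apply: xB; apply/imsetP; exists x; rewrite ?inE.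
Qed.

End Switching.

(** * Two commuting reflections: at least k switchable orbits *)

Section TwoReflections.
Variables (T : finType) (adj : rel T) (s t : T -> T) (c : T) (k : nat).
Hypotheses (sK : involutive s) (tK : involutive t).
Hypothesis t_adj : forall x y, adj x y -> adj (t x) (t y).
Hypothesis stC : forall x, s (t x) = t (s x).
Hypothesis s_indep : forall x y, s x = x -> s y = y -> ~~ adj x y.
Hypothesis t_indep : forall x y, t x = x -> t y = y -> ~~ adj x y.
Hypothesis fixed_st : forall x, s x = x -> t x = x -> x = c.
Hypothesis t_c : t c = c.
Hypothesis card_fixed_s : #|[set x | s x == x]| = (2 * k).+1.
Hypothesis card_fixed_t : #|[set x | t x == x]| = (2 * k).+1.
Implicit Type f : {ffun T -> T}.
Notation X := (near_perfect_involutions adj).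

(** An orbit through a fixed point of [s] is one cycle of [s \o f], and [s] reverses this cycle. *)
Lemma card_component_fixed_le2 f x : involutive f ->
  #|[set y in component s f x | s y == y]| <= 2.
Proof.
move=> fK; have [->|[d]] := set_0Vmem [set y in component s f x | s y == y].
  by rewrite cards0.
rewrite inE => /andP[xd /eqP sd]; rewrite -(component_eq sK fK xd).
rewrite component_fixed //; under eq_finset do rewrite inE.
apply: card_fixed_orbit_le2 => [|y _] /=; last by rewrite sK fK.
by apply: inj_comp; apply: can_inj; eauto.
Qed.

(** Where [t f t = s f s], the reflection [t] also reverses the cycle of [s \o f], because it
    commutes with [s]. *)
Lemma card_component_fixed_other_le2 f d : involutive f -> s d = d ->
    (forall y, y \in component s f d -> t (f (t y)) = s (f (s y))) ->
  #|[set y in component s f d | t y == y]| <= 2.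
Proof.
move=> fK sd tf; rewrite component_fixed //; under eq_finset do rewrite inE.
apply: card_fixed_orbit_le2 => [|y dy] /=.
  by apply: inj_comp; apply: can_inj; eauto.
have dcy : y \in component s f d by rewrite component_fixed // inE.
have: s y \in component s f d.
  by rewrite -(component_eq sK fK dcy) -(component_s sK _ fK) component_id.
move/tf; rewrite sK => e.
by rewrite -e tK fK stC sK.
Qed.

Definition moved_fixed_points f := [set x | s x == x & f x != x].

(** If [f] and [s f s] agreed at an axis vertex [x], then [f x] would lie on the axis too, but no
    two axis vertices are adjacent. *)
Lemma switchable_moved f x : f \in X ->
  x \in moved_fixed_points f -> component s f x \in switchable s f.
Proof.
move=> /npiP[_ fadj _]; rewrite inE => /andP[/eqP sx fx].
apply/imsetP; exists x => //; rewrite inE sx; apply: contra fx => /eqP /esym sfx.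
by case: (fadj x) => [->//|]; rewrite (negbTE (s_indep _ _)).
Qed.

Lemma card_moved_le f : f \in X ->
  #|moved_fixed_points f| <= 2 * #|component s f @: moved_fixed_points f|.
Proof.
move=> fX; have [fK _ _] := npiP _ _ fX.
apply: card_le_fibers => x xD; apply: leq_trans (card_component_fixed_le2 x fK).
apply/subset_leq_card/subsetP => y; rewrite !inE => /andP[/andP[-> _] /eqP e].
by have := component_id s f y; rewrite e inE => ->.
Qed.

Lemma components_moved_sub f : f \in X ->
  component s f @: moved_fixed_points f \subset switchable s f.
Proof. by move=> fX; apply/subsetP=> _ /imsetP[x xD ->]; apply: switchable_moved. Qed.

Lemma card_moved_ge f : f \in X -> 2 * k <= #|moved_fixed_points f|.
Proof.
case/npiP=> _ _ [v fv]; rewrite -ltnS -card_fixed_s.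
apply: leq_trans (_ : #|v |: moved_fixed_points f| <= _).
  apply/subset_leq_card/subsetP => x; rewrite !inE => ->.
  by case: eqVneq => //= xv; apply: contra xv => /eqP /fv ->.
by rewrite cardsU1; case: (_ \notin _) => //; apply: leqW.
Qed.

(** At least [2k] axis vertices are matched, each in a switchable orbit, and an orbit holds at most
    two of them. *)
Lemma card_switchable_ge f : f \in X -> k <= #|switchable s f|.
Proof.
move=> fX; rewrite -(leq_pmul2l (isT : 0 < 2)).
apply: leq_trans (card_moved_ge fX) (leq_trans (card_moved_le fX) _).
by rewrite leq_pmul2l // subset_leq_card // components_moved_sub.
Qed.

(** * The extremal case: exactly k switchable orbits and a superposition invariant under t *)

Section Symmetric.
Variable f : {ffun T -> T}.
Hypothesis fX : f \in X.
Hypothesis symf : superposition s (conj_fun t t f) = superposition s f.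
Hypothesis card_f : #|switchable s f| = k.

Let fK : involutive f. Proof. by case/npiP: fX. Qed.

Lemma symmetric_cases x :
  t (f (t x)) = f x \/ t (f (t x)) = s (f (s x)).
Proof.
by have [[<- _]|[<- _]] := superposition_eq_cases x symf; rewrite ffunE; auto.
Qed.

(** At each vertex [t f t] has the value of [f] or of [s f s], and both values stay in the orbit;
    hence [t] permutes the orbits. *)
Lemma component_t x y : y \in component s f x -> t y \in component s f (t x).
Proof.
move=> xy; apply: (component_min (P := fun u => t u \in component s f (t x)) _ _ xy);
  last exact: component_id; move=> u.
  move=> utx; rewrite -(component_eq sK fK utx) -[u in f u]tK.
  case: (symmetric_cases (t u)) => ->; last rewrite -(component_s sK (t u) fK).
    by rewrite -(component_f sK _ fK) component_id.
  by rewrite -(component_f sK _ fK) -(component_s sK _ fK) component_id.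
by move=> utx; rewrite -stC -(component_eq sK fK utx) -(component_s sK _ fK) component_id.
Qed.

Lemma components_moved : component s f @: moved_fixed_points f = switchable s f.
Proof.
apply/eqP; rewrite eqEcard components_moved_sub //= card_f.
rewrite -(leq_pmul2l (isT : 0 < 2)).
exact: leq_trans (card_moved_ge fX) (card_moved_le fX).
Qed.

Lemma symmetric_center x : f x = x <-> x = c.
Proof.
case/npiP: fX => _ _ [v fv]; suff <-: v = c by apply: fv.
have fvv : f v = v by apply/fv.
have sv : s v = v.
  (* Were the monomer off the axis, all [2k+1] axis vertices would be matched, but the [k] orbits
     have room for only [2k]. *)
  apply/eqP/negPn/negP => sv; suff: (2 * k).+1 <= 2 * k by rewrite ltnn.
  rewrite -card_fixed_s -card_f -components_moved.
  apply: leq_trans (card_moved_le fX); apply/subset_leq_card/subsetP => y.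
  rewrite !inE => sy; rewrite sy; apply: contra sv => /eqP /fv e.
  by rewrite -e.
(* In either case [t v] is fixed by [f] as well, so it equals [v], which then lies on both axes. *)
apply: fixed_st => //; apply/fv; have [|] := symmetric_cases (t v); rewrite tK fvv => //.
by rewrite stC sv => e; apply: (can_inj sK); rewrite -e stC sv.
Qed.

Definition other_axis := [set x | t x == x & x != c].

(** At [a] the values of [t f t] and [f] differ, since otherwise [a] would be matched along the
    [t]-axis. The difference spreads over the orbit, and there [t f t] can only be [s f s]. *)
Lemma other_axis_component a : a \in other_axis ->
  component s f a \in switchable s f /\
  forall y, y \in component s f a -> t (f (t y)) = s (f (s y)).
Proof.
rewrite inE => /andP[/eqP ta ac].
have gfa : conj_fun t t f a != f a.
  rewrite ffunE ta; apply: contra ac => /eqP tfa; apply/eqP/symmetric_center.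
  by have [_ fadj _] := npiP _ _ fX; case: (fadj a) => //; rewrite (negbTE (t_indep ta tfa)).
split=> [|y ay].
  apply/imsetP; exists a => //; rewrite inE.
  by move: gfa; rewrite ffunE eq_sym; case: (symmetric_cases a) => ->; rewrite ?eqxx.
have: conj_fun t t f y != f y.
  by rewrite (eq_superposition_component sK fX _ symf ay) // conj_fun_npi.
by rewrite ffunE; case: (symmetric_cases y) => ->; rewrite ?eqxx.
Qed.

(** The [2k] vertices of the [t]-axis other than [c] lie in switchable orbits, at most two in each,
    so they meet all [k] of these. *)
Lemma components_other_axis : component s f @: other_axis = switchable s f.
Proof.
apply/eqP; rewrite eqEcard; apply/andP; split.
  by apply/subsetP=> _ /imsetP[a /other_axis_component[aO _] ->].
rewrite card_f -(leq_pmul2l (isT : 0 < 2)).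
apply: (@leq_trans #|other_axis|).
  rewrite -ltnS -card_fixed_t (cardsD1 c) inE t_c eqxx ltnS.
  by apply/subset_leq_card/subsetP => x; rewrite !inE andbC.
apply: card_le_fibers => a /other_axis_component[aO tf].
move: aO; rewrite -components_moved => /imsetP[d]; rewrite inE => /andP[/eqP sd _] e.
rewrite e in tf *; apply: leq_trans (card_component_fixed_other_le2 fK sd tf).
apply/subset_leq_card/subsetP => y; rewrite !inE => /andP[/andP[-> _] /eqP def_d].
by have := component_id s f y; rewrite def_d inE => ->.
Qed.

(** The orbit of [d] meets the [t]-axis, so [t] preserves it and it contains [d] and [t d]; there is
    no room for a third vertex fixed by [s]. *)
Lemma symmetric_component_fixed d d' : s d = d -> s d' = d' -> d != c ->
  component s f d = component s f d' -> d' = d \/ d' = t d.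
Proof.
move=> sd sd' dc e.
have: component s f d \in switchable s f.
  apply: switchable_moved; rewrite // inE sd eqxx.
  by apply: contra dc => /eqP /symmetric_center ->.
rewrite -components_other_axis => /imsetP[a]; rewrite inE => /andP[/eqP ta _] da.
have dtd : t d \in component s f d.
  by rewrite da -ta component_t // -da component_id.
have td : d != t d by apply: contra dc => /eqP e'; apply/eqP/fixed_st.
have [->|d'd] := eqVneq d' d; first by left.
right; apply/eqP/negPn/negP => d'td.
suff: 3 <= 2 by [].
apply: leq_trans (card_component_fixed_le2 d fK).
rewrite (_ : 3 = #|d' |: [set d; t d]|).
  apply/subset_leq_card/subsetP => y; rewrite [y \in [set _ in _ | _]]inE !in_setU !in_set1.
  case/or3P=> /eqP->; first by rewrite e component_id sd' eqxx.
    by rewrite component_id sd eqxx.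
  by rewrite dtd stC sd eqxx.
by rewrite cardsU1 cards2 !inE negb_or d'd d'td td.
Qed.

End Symmetric.
End TwoReflections.

(** * The odd square grid and its symmetries *)

Section Grid.
Variable k : nat.
Notation N := (2 * k).+1.
Notation V := (grid_vertex N N).
Implicit Types (x y : V) (f g : {ffun V -> V}).
Notation X := (near_perfect_involutions (@grid_adj N N)).

Definition transpose x : V := (x.2, x.1).
Definition antitranspose x : V := (rev_ord x.2, rev_ord x.1).
Definition rotate x : V := (x.2, rev_ord x.1).
Definition rotate_inv x : V := (rev_ord x.2, x.1).
Definition center : V := (inord k, inord k).

Lemma vertex_ext x y : x.1 = y.1 :> nat -> x.2 = y.2 :> nat -> x = y.
Proof. by case: x y => [x1 x2] [y1 y2] /= /val_inj-> /val_inj->. Qed.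

Lemma grid_adjE x y : grid_adj x y =
  ((x.1 == y.1.+1 :> nat) || (y.1 == x.1.+1 :> nat)) && (x.2 == y.2 :> nat)
  || (x.1 == y.1 :> nat) && ((x.2 == y.2.+1 :> nat) || (y.2 == x.2.+1 :> nat)).
Proof. by []. Qed.

Lemma center1 : center.1 = k :> nat. Proof. by rewrite /= inordK; lia. Qed.
Lemma center2 : center.2 = k :> nat. Proof. by rewrite /= inordK; lia. Qed.

Lemma grid_adj_sym : symmetric (@grid_adj N N).
Proof. move=> x y; rewrite !grid_adjE; lia. Qed.

Lemma grid_adj_irr : irreflexive (@grid_adj N N).
Proof. move=> x; rewrite !grid_adjE; lia. Qed.

Lemma transposeK : involutive transpose. Proof. by case. Qed.
Lemma antitransposeK : involutive antitranspose.
Proof. by case=> x1 x2; rewrite /antitranspose /= !rev_ordK. Qed.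
Lemma rotateK : cancel rotate rotate_inv.
Proof. by case=> x1 x2; rewrite /rotate_inv /rotate /= rev_ordK. Qed.
Lemma rotate_invK : cancel rotate_inv rotate.
Proof. by case=> x1 x2; rewrite /rotate_inv /rotate /= rev_ordK. Qed.

Lemma transpose_adj x y : grid_adj x y -> grid_adj (transpose x) (transpose y).
Proof. rewrite !grid_adjE /=; lia. Qed.
Lemma antitranspose_adj x y :
  grid_adj x y -> grid_adj (antitranspose x) (antitranspose y).
Proof.
case: x y => [[x1 lx1] [x2 lx2]] [[y1 ly1] [y2 ly2]]; rewrite !grid_adjE /=.
lia.
Qed.
Lemma rotate_inv_adj x y : grid_adj x y -> grid_adj (rotate_inv x) (rotate_inv y).
Proof.
case: x y => [[x1 lx1] [x2 lx2]] [[y1 ly1] [y2 ly2]]; rewrite !grid_adjE /=.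
lia.
Qed.

Lemma transpose_fixed x : transpose x = x <-> x.1 = x.2 :> nat.
Proof.
case: x => x1 x2; rewrite /transpose /=; split=> [[->]//|/val_inj->//].
Qed.

Lemma antitranspose_fixed x : antitranspose x = x <-> x.1 + x.2 = 2 * k.
Proof.
case: x => x1 x2; rewrite /antitranspose /=; split.
  by case=> <- _ /=; have := ltn_ord x2; lia.
by move=> e; apply: vertex_ext => /=; have := ltn_ord x2; lia.
Qed.

Lemma center_transpose : transpose center = center.
Proof. by apply/transpose_fixed; rewrite center1 ?center2. Qed.
Lemma center_antitranspose : antitranspose center = center.
Proof. by apply/antitranspose_fixed; rewrite center1 ?center2; lia. Qed.
Lemma center_rotate : rotate center = center.
Proof. apply: vertex_ext; rewrite /= ?inordK; lia. Qed.

Lemma center_unique x : transpose x = x -> antitranspose x = x -> x = center.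
Proof.
move=> /transpose_fixed e1 /antitranspose_fixed e2.
by apply: vertex_ext; rewrite ?center1 ?center2; lia.
Qed.

Lemma transpose_indep x y : transpose x = x -> transpose y = y -> ~~ grid_adj x y.
Proof. by move=> /transpose_fixed ex /transpose_fixed ey; rewrite grid_adjE; lia. Qed.
Lemma antitranspose_indep x y :
  antitranspose x = x -> antitranspose y = y -> ~~ grid_adj x y.
Proof. by move=> /antitranspose_fixed ex /antitranspose_fixed ey; rewrite grid_adjE; lia. Qed.

Lemma card_transpose_fixed : #|[set x | transpose x == x]| = N.
Proof.
rewrite -[RHS]card_ord -cardsT -(card_imset (f := fun i : 'I_N => (i, i) : V)).
  apply: eq_card => -[x1 x2]; rewrite !inE; apply/eqP/imsetP => [[->]|[i _ [-> ->]]//].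
  by exists x1.
by move=> i j [].
Qed.

Lemma card_antitranspose_fixed : #|[set x | antitranspose x == x]| = N.
Proof.
rewrite -[RHS]card_ord -cardsT -(card_imset (f := fun i : 'I_N => (i, rev_ord i) : V)).
  apply: eq_card => -[x1 x2]; rewrite !inE; apply/eqP/imsetP => [[_ <-]|[i _ [-> ->]]].
    by exists x1.
  by rewrite /antitranspose /= rev_ordK.
by move=> i j [].
Qed.

(** * Uniqueness of the pinwheel *)

Definition pinwheel_like f :=
  [/\ f \in X, f center = center
    & forall x, x.1 = x.2 :> nat -> x.1 < k -> (f x).1 < (f x).2].

Lemma pinwheel_adj f x : pinwheel_like f -> x != center -> grid_adj x (f x).
Proof.
case=> /npiP[_ fadj [v fv]] fc _ xc; case: (fadj x) => // /fv xv.
by move/fv: fc => cv; rewrite xv cv eqxx in xc.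
Qed.

(** Strong induction on the column. The left, upper and lower neighbours of [x] are already partners
    of even vertices in earlier columns, except that on the diagonal the left and lower ones are
    excluded by [pinwheel_like]. Only the right neighbour remains. *)
Lemma top_forced f x : pinwheel_like f ->
    ~~ odd (x.1 + x.2) -> x.1 <= x.2 -> x.1 + x.2 < 2 * k ->
  (f x).1 = x.1 :> nat /\ (f x).2 = x.2.+1 :> nat.
Proof.
move=> pf; have [/npiP[fK _ _] _ fdiag] := pf.
elim/ltn_ind: {x}(x.2 : nat) {-2}x (erefl (x.2 : nat)) => m IHm x def_m ox x12 xk.
have xc : x != center by apply/eqP => e; move: xk; rewrite e center1 ?center2; lia.
(* If [f x] were the partner of an even vertex in an earlier column, injectivity of [f] would make
   [x] that vertex. *)
have taken i j : ~~ odd (i + j) -> i <= j -> i + j < 2 * k -> j < x.2 ->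
    (f x).1 = i :> nat -> (f x).2 = j.+1 :> nat -> False.
  move=> oij ij ijk jx e1 e2; pose y : V := (inord i, inord j).
  have y1 : y.1 = i :> nat by rewrite /= inordK; lia.
  have y2 : y.2 = j :> nat by rewrite /= inordK; lia.
  have [||||| fy1 fy2] := IHm j _ y; rewrite ?y1 ?y2 -?def_m //.
  have xy : x = y by apply: (can_inj fK); apply: vertex_ext; rewrite ?fy1 ?fy2 ?y1 ?y2.
  by move: jx; rewrite xy y2 ltnn.
have := pinwheel_adj pf xc; rewrite grid_adjE.
have [x1x2|x1x2] := eqVneq (x.1 : nat) x.2.
  have {}fdiag : (f x).1 < (f x).2 by apply: fdiag; lia.
  case/orP=> /andP[]; last by lia.
  move=> /orP[]/eqP e1 /eqP e2; last by lia.
  by case: (@taken x.1.-1 x.2.-1); lia.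
case/orP=> /andP[].
  by move=> /orP[]/eqP e1 /eqP e2;
    [case: (@taken x.1.-1 x.2.-1) | case: (@taken x.1.+1 x.2.-1)]; lia.
move=> /eqP e1 /orP[]/eqP e2; last by lia.
by case: (@taken x.1 x.2.-2); lia.
Qed.

Definition rotated f : {ffun V -> V} := conj_fun rotate rotate_inv f.

(** The quarter turn takes the diagonal vertex in row [i] to the corner [(i, 2k-i)]. Its left and
    upper neighbours are taken by [top_forced], so it is matched to the right or downwards, which
    turns back to a partner above the diagonal. *)
Lemma rotated_pinwheel f : pinwheel_like f -> pinwheel_like (rotated f).
Proof.
move=> pf; have [fX fc _] := pf; have [fK _ _] := npiP _ _ fX; split.
- exact: conj_fun_npi rotateK rotate_invK rotate_inv_adj fX.
- by rewrite ffunE center_rotate fc -{1}center_rotate rotateK.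
case=> -[x1 lx1] [x2 lx2] /= x12 xk; rewrite ffunE; set y := rotate _.
have y1 : y.1 = x1 :> nat by rewrite x12.
have y2 : y.2 = 2 * k - x1 :> nat by rewrite /=; lia.
have yc : y != center by apply/eqP => e; move: y1; rewrite e center1; lia.
move: y1 y2 yc; move: y => y y1 y2 yc.
have taken i j : ~~ odd (i + j) -> i <= j -> i + j < 2 * k ->
    (f y).1 = i :> nat -> (f y).2 = j.+1 :> nat -> False.
  move=> oij ij ijk e1 e2; pose z : V := (inord i, inord j).
  have z1 : z.1 = i :> nat by rewrite /= inordK; lia.
  have z2 : z.2 = j :> nat by rewrite /= inordK; lia.
  have [|||fz1 fz2] := @top_forced f z pf; rewrite ?z1 ?z2 //.
  have yz : y = z by apply: (can_inj fK); apply: vertex_ext; rewrite ?fz1 ?fz2 ?z1 ?z2.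
  by move: y1 y2; rewrite yz z1 z2; lia.
have := pinwheel_adj pf yc; rewrite grid_adjE y1 y2.
case: (f y) taken => [[u lu] [w lw]] /= taken ady.
have [|h] := ltnP (2 * k - w) u; first by lia.
exfalso; case/orP: ady => /andP[].
  move=> /orP[]/eqP e1 /eqP e2; last by lia.
  by apply: (@taken x1.-1 (2 * k - x1).-1); lia.
move=> /eqP e1 /orP[]/eqP e2; last by lia.
by apply: (@taken x1 (2 * k - x1).-2); lia.
Qed.

Lemma pinwheel_eq_rotated f g e x : pinwheel_like f -> pinwheel_like g ->
    ~~ odd (x.1 + x.2) -> x.1 <= x.2 -> x.1 + x.2 < 2 * k ->
  f (iter e rotate x) = g (iter e rotate x).
Proof.
elim: e f g => [|e IHe] f g pf pg ox x12 xk.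
  have [f1 f2] := top_forced pf ox x12 xk; have [g1 g2] := top_forced pg ox x12 xk.
  by apply: vertex_ext; rewrite ?f1 ?g1 ?f2 ?g2.
have := IHe _ _ (rotated_pinwheel pf) (rotated_pinwheel pg) ox x12 xk.
by rewrite !ffunE => /(can_inj rotate_invK).
Qed.

Lemma even_vertex_rotation x : ~~ odd (x.1 + x.2) -> x != center ->
  exists e, exists y : V, [/\ x = iter e rotate y, ~~ odd (y.1 + y.2),
                             y.1 <= y.2 & y.1 + y.2 < 2 * k].
Proof.
move=> ox xc.
have {xc} : ~ (x.1 = k :> nat /\ x.2 = k :> nat).
  case=> e1 e2; case/eqP: xc; apply: vertex_ext; by rewrite ?center1 ?center2.
have rotK e y : iter e rotate (iter e rotate_inv y) = y.
  by elim: e y => [|e IHe] y //; rewrite iterSr iterS rotate_invK IHe.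
case: x ox => [[i li] [j lj]] /= ox xc.
have [h0|h0] := boolP ((i <= j) && (i + j < 2 * k)).
  by exists 0; exists (Ordinal li, Ordinal lj); case/andP: h0.
have [h1|h1] := boolP ((i < j) && (2 * k <= i + j)).
  by exists 1; exists (iter 1 rotate_inv (Ordinal li, Ordinal lj)); rewrite rotK /=; split=> //; lia.
have [h2|h2] := boolP ((j <= i) && (2 * k < i + j)).
  by exists 2; exists (iter 2 rotate_inv (Ordinal li, Ordinal lj)); rewrite rotK /=; split=> //; lia.
by exists 3; exists (iter 3 rotate_inv (Ordinal li, Ordinal lj)); rewrite rotK /=; split=> //; lia.
Qed.

(** The four rotated copies of the top quadrant cover all even vertices but the center, so [f] and
    [g] agree on even vertices. An odd vertex is matched to an even one, which settles the rest. *)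
Lemma pinwheel_unique f g : pinwheel_like f -> pinwheel_like g -> f = g.
Proof.
move=> pf pg; have [/npiP[fK _ _] fc _] := pf; have [/npiP[gK _ _] gc _] := pg.
have fg_even x : ~~ odd (x.1 + x.2) -> f x = g x.
  move=> ox; have [->|xc] := eqVneq x center; first by rewrite fc gc.
  by have [e [y [-> oy y12 yk]]] := even_vertex_rotation ox xc; apply: pinwheel_eq_rotated.
apply/ffunP => x; have [ox|] := boolP (odd (x.1 + x.2)); last exact: fg_even.
have xc : x != center by apply/eqP => e; move: ox; rewrite e center1 ?center2; lia.
apply: (can_inj gK); rewrite gK -fg_even ?fK //.
by have := pinwheel_adj pf xc; rewrite grid_adjE; lia.
Qed.

(** * Construction of the pinwheel *)

(** The branches are the top, right, bottom and left quadrants, then the center. Even vertices step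
    clockwise around their ring, odd ones step back. *)
Definition pinwheel_step (i j : nat) : nat * nat :=
  if (i <= j) && (i + j < 2 * k) then (i, if odd (i + j) then j.-1 else j.+1)
  else if i < j then (if odd (i + j) then i.-1 else i.+1, j)
  else if 2 * k < i + j then (i, if odd (i + j) then j.+1 else j.-1)
  else if j < i then (if odd (i + j) then i.+1 else i.-1, j)
  else (i, j).

Definition pinwheel : {ffun V -> V} :=
  [ffun x : V => let s := pinwheel_step x.1 x.2 in (inord s.1, inord s.2)].

Lemma pinwheel_stepK i j : i < N -> j < N ->
  pinwheel_step (pinwheel_step i j).1 (pinwheel_step i j).2 = (i, j).
Proof.
move=> li lj; rewrite {2 3}/pinwheel_step.
by do ?case: ifP => ?; rewrite /pinwheel_step /=; do ?case: ifP => ?; congr pair; lia.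
Qed.

Lemma pinwheel_step_lt i j : i < N -> j < N ->
  (pinwheel_step i j).1 < N /\ (pinwheel_step i j).2 < N.
Proof. by move=> li lj; rewrite /pinwheel_step; do ?case: ifP => ? /=; lia. Qed.

Lemma pinwheel1 x : (pinwheel x).1 = (pinwheel_step x.1 x.2).1 :> nat.
Proof.
by rewrite ffunE /= inordK //; have [] := pinwheel_step_lt (ltn_ord x.1) (ltn_ord x.2).
Qed.

Lemma pinwheel2 x : (pinwheel x).2 = (pinwheel_step x.1 x.2).2 :> nat.
Proof.
by rewrite ffunE /= inordK //; have [] := pinwheel_step_lt (ltn_ord x.1) (ltn_ord x.2).
Qed.

Lemma pinwheel_step_adj i j : i < N -> j < N ->
  let s := pinwheel_step i j in
  [/\ i = k, j = k & s = (i, j)] \/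
  (((i == s.1.+1) || (s.1 == i.+1)) && (j == s.2)
  || (i == s.1) && ((j == s.2.+1) || (s.2 == j.+1))).
Proof.
move=> li lj; rewrite /pinwheel_step.
do ?case: ifP => ? /=; try by right; lia.
by left; split=> //; lia.
Qed.

Lemma pinwheelP : pinwheel_like pinwheel.
Proof.
have pin_adj x : x = center /\ pinwheel x = x \/ grid_adj x (pinwheel x).
  rewrite grid_adjE pinwheel1 pinwheel2.
  have [[e1 e2 e]|] := pinwheel_step_adj (ltn_ord x.1) (ltn_ord x.2); last by right.
  by left; split; apply: vertex_ext; rewrite ?pinwheel1 ?pinwheel2 ?e ?center1 ?center2.
have pin_c : pinwheel center = center.
  apply: vertex_ext; rewrite ?pinwheel1 ?pinwheel2 center1 ?center2 /pinwheel_step;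
  by do ?case: ifP => ? /=; lia.
split=> //; last first.
  case=> -[i li] [j lj] /= ij ik; rewrite pinwheel1 pinwheel2 /= /pinwheel_step.
  by do ?case: ifP => ? /=; lia.
apply/npiP; split=> [x|x|].
- by apply: vertex_ext; rewrite !(pinwheel1, pinwheel2) pinwheel_stepK.
- by case: (pin_adj x) => [[_ ->]|]; auto.
exists center => x; split=> [px|->//].
by case: (pin_adj x) => [[-> _]//|]; rewrite px grid_adj_irr.
Qed.

(** * Extremal superpositions and the parity count *)

(** For the upper bound, every switchable orbit contains one of the first [k] diagonal vertices. *)
Lemma card_switchable_pinwheel : #|switchable transpose pinwheel| = k.
Proof.
have pp := pinwheelP; have [pX pc pdiag] := pp; have [pK _ _] := npiP _ _ pX.
apply/eqP; rewrite eqn_leq (card_switchable_ge transposeK transpose_indep card_transpose_fixed pX) andbT.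
pose d (i : 'I_k) : V := (inord i, inord i).
rewrite -[leqRHS]card_ord -cardsT.
apply: leq_trans (leq_imset_card (fun i => component transpose pinwheel (d i)) _).
apply/subset_leq_card/subsetP => C /imsetP[x]; rewrite inE => px def_C.
apply/imsetP; suff /existsP[i xi] : [exists i, d i \in C].
  by exists i; rewrite // def_C; apply/esym/(component_eq transposeK pK); rewrite -def_C.
(* Switching C would give a second matching satisfying pinwheel_like. *)
apply: contraT => /existsPn no_d.
suff e : switch transpose pinwheel C = pinwheel.
  move/ffunP/(_ x): e; rewrite ffunE {1}def_C component_id => /eqP.
  by rewrite eq_sym (negbTE px).
apply: pinwheel_unique => //; split.
- apply: switch_npi => // [||y|y]; first exact: transpose_adj.
  + exact: transposeK.
  + by rewrite def_C !(mem_component transposeK _ _ pK) (component_f transposeK _ pK).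
  + by rewrite def_C !(mem_component transposeK _ _ pK) (component_s transposeK _ pK).
- by rewrite ffunE center_transpose pc center_transpose if_same.
move=> y y12 yk; rewrite ffunE ifN; first exact: pdiag.
apply: contra (no_d (Ordinal yk)); rewrite (_ : d _ = y) //.
by case: y y12 yk => [[i li] [j lj]] /= ij ik; apply: vertex_ext; rewrite /= inordK; lia.
Qed.

Lemma pinwheel_like_of_symmetric f : f \in X ->
    superposition transpose (conj_fun antitranspose antitranspose f)
      = superposition transpose f ->
    #|switchable transpose f| = k ->
  superposition transpose f = superposition transpose pinwheel.
Proof.
move=> fX symf card_f; have [fK fadj _] := npiP _ _ fX.
pose comp := component transpose f.
have comp_f := component_f transposeK _ fK.
have comp_s := component_s transposeK _ fK.
(* [A] is the union of the orbits through those of the first [k] diagonal vertices that are matched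
   below the diagonal; switching it should put all these partners above. *)
pose A := [set x | [exists d : V, [&& d.1 == d.2 :> nat, d.1 < k,
                                     (f d).2 < (f d).1 & comp d == comp x]]].
have fA x : (f x \in A) = (x \in A) by rewrite !inE /comp comp_f.
have sA x : (transpose x \in A) = (x \in A) by rewrite !inE /comp comp_s.
rewrite -(superposition_switch transposeK f sA); congr superposition.
have fixed_f x : f x = x <-> x = center.
  exact: (symmetric_center transposeK antitransposeK _ transpose_indep
            center_unique card_transpose_fixed fX symf card_f).
have fc : f center = center by apply/fixed_f.
apply: pinwheel_unique pinwheelP; split.
- by apply: switch_npi => // [|]; [apply: transpose_adj | apply: transposeK].
- by rewrite ffunE center_transpose fc center_transpose if_same.
move=> d d12 dk; have sd := proj2 (transpose_fixed d) d12; rewrite ffunE sd.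
have dc : d != center by apply/eqP => e; move: dk; rewrite e center1; lia.
have fdd : (f d).1 <> (f d).2 :> nat.
  move/transpose_fixed => sfd; case: (fadj d) => [/fixed_f/eqP|]; first exact/negP.
  by rewrite (negbTE (transpose_indep sd sfd)).
case: ifPn => [|dA].
  rewrite inE => /existsP[d' /and4P[/eqP d'12 d'k fd' /eqP dd']].
  have sd' := proj2 (transpose_fixed d') d'12.
  have [e|e] := symmetric_component_fixed transposeK antitransposeK antitranspose_adj
    (fun _ => erefl) transpose_indep antitranspose_indep center_unique
    center_antitranspose card_transpose_fixed card_antitranspose_fixed fX symf
    card_f sd sd' dc (esym dd'); first by rewrite -e.
  (* The antidiagonal reflection of [d] lies beyond the center on the diagonal, so it is not among
     the first [k]. *)
  by exfalso; move: d'k d12 dk; rewrite e; case: (d) => [[i li] [j lj]] /=; lia.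
rewrite ltn_neqAle; apply/andP; split; first exact/eqP.
rewrite leqNgt; apply: contra dA => lt; rewrite inE; apply/existsP; exists d.
by rewrite dk lt d12 !eqxx.
Qed.

(** The cofactor is the sum over superpositions of [w], a fiber size divided by [2^k], which is odd
    exactly for [k] switchable orbits. The antidiagonal reflection acts on superpositions and
    preserves [w]; its only fixed point of odd weight is that of the pinwheel. *)
Lemma odd_part_near_perfect : exists c, odd c /\ #|X| = 2 ^ k * c.
Proof.
pose h := superposition transpose; pose conj := conj_fun antitranspose antitranspose.
have conjK : involutive conj.
  by move=> f; apply/ffunP => x; rewrite !ffunE !antitransposeK.
have conj_X f : (conj f \in X) = (f \in X).
  have conj_X1 g : g \in X -> conj g \in X.
    apply: conj_fun_npi; try exact: antitransposeK; exact: antitranspose_adj.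
  by apply/idP/idP => /conj_X1 //; rewrite conjK.
pose t (y : {ffun V -> {set V}}) : {ffun V -> {set V}} :=
  [ffun x => antitranspose @: y (antitranspose x)].
have tK : involutive t.
  move=> y; apply/ffunP => x; rewrite !ffunE antitransposeK -imset_comp.
  by rewrite (eq_imset _ antitransposeK) imset_id.
have h_conj f : h (conj f) = t (h f).
  apply/ffunP => x; rewrite !ffunE imsetU !imset_set1 //.
pose fiber (y : {ffun V -> {set V}}) := [set g in X | h g == y].
pose w (y : {ffun V -> {set V}}) := #|fiber y| %/ 2 ^ k.
have card_fiber (f : {ffun V -> V}) : f \in X -> #|fiber (h f)| = 2 ^ #|switchable transpose f|.
  exact: (card_superposition_fiber transpose_adj transposeK).
have ge_k f : f \in X -> k <= #|switchable transpose f|.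
  exact: (card_switchable_ge transposeK transpose_indep card_transpose_fixed).
have w_h f : f \in X -> w (h f) = 2 ^ (#|switchable transpose f| - k).
  by move=> fX; rewrite /w card_fiber // expnB ?ge_k.
have w_t (y : {ffun V -> {set V}}) : w (t y) = w y.
  congr (_ %/ _); rewrite -[RHS](card_preimset _ (inv_inj conjK)).
  apply: eq_card => g; rewrite [LHS]inE [RHS]inE [RHS]inE conj_X h_conj; congr (_ && _).
  by rewrite -(inj_eq (inv_inj tK)) tK.
have pp := pinwheelP; have [pX _ _] := pp.
have t_pin : t (h pinwheel) = h pinwheel.
  (* By uniqueness the pinwheel is invariant under the half turn, the product of both reflections,
     so conjugating it by either gives the same involution. *)
  have r : pinwheel = rotated (rotated pinwheel).
    by apply: pinwheel_unique => //; do 2!apply: rotated_pinwheel.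
  have cs x : antitranspose (pinwheel (antitranspose x)) =
              transpose (pinwheel (transpose x)).
    rewrite {1}r; move: (pinwheel) => g.
    by rewrite !ffunE /rotate /rotate_inv /antitranspose /transpose /= !rev_ordK.
  rewrite -h_conj; move: cs; move: (pinwheel) => g cs.
  by apply/ffunP => x; rewrite !ffunE !cs !transposeK setUC.
exists (\sum_(y in h @: X) w y); split; last first.
  rewrite -sum1_card (partition_big_imset h) /= big_distrr /=.
  apply: eq_bigr => y /imsetP[f fX ->].
  rewrite w_h // -expnD subnKC ?ge_k // -card_fiber // -sum1_card.
  by apply: eq_bigl => g; rewrite [RHS]inE.
rewrite odd_sum; apply: (@odd_card_unique_fixpoint _ t _ (h pinwheel)) => //.
- move=> y; rewrite !inE w_t => /andP[/imsetP[f fX ->] ->]; rewrite andbT.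
  by rewrite -h_conj imset_f ?conj_X.
- by rewrite inE imset_f //= w_h // card_switchable_pinwheel subnn.
move=> y; rewrite inE => /andP[/imsetP[f fX ->]]; rewrite w_h // oddX orbF => ek.
split=> [|->//]; rewrite -h_conj => symf; apply: pinwheel_like_of_symmetric => //.
by have := ge_k f fX; lia.
Qed.

End Grid.

Theorem theorem2 (k : nat) :
  exists c : nat, odd c /\ a (2 * k + 1) = 2 ^ k * c.
Proof.
rewrite addn1 /a (num_near_perfect_matchingsE (@grid_adj_irr k) (@grid_adj_sym k)).
exact: odd_part_near_perfect.
Qed.
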